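(* Let $n>5$ and let $R$ be an $(n+1)$-dimensional solvable complex Leibniz algebra whose nilradical is isomorphic to $g^2_{(n,1)}$. Then $R$ has a basis $\{e_1,\dots,e_n,x\}$ such that $\{e_1,\dots,e_n\}$ spans the nilradical with the brackets of $g^2_{(n,1)}$ (given in the context), and the brackets involving $x$ are of one of the following types (brackets involving $x$ not listed, including $[x,x]$ unless listed, are zero; parameters are complex): $R_1(b_4,\dots,b_{n-1})$: $[e_i,x]=-[x,e_i]=e_i+\sum_{t=i+2}^{n-1}b_{t-i+2}e_t$ for $2\le i\le n-1$. $R_2(a_2)$: $[e_1,x]=-[x,e_1]=e_1+a_2e_2$; $[e_i,x]=-[x,e_i]=(i-1)e_i$ for $2\le i\le n-1$; $[e_n,x]=-[x,e_n]=-a_2e_3+2e_n$. $R_3(\gamma_{n-1})$: $[e_1,x]=-[x,e_1]=e_1$; $[e_i,x]=-[x,e_i]=(i+3-n)e_i$ for $2\le i\le n-1$; $[e_n,x]=-[x,e_n]=\gamma_{n-1}e_{n-1}+2e_n$. $R_4(\delta_{n-1})$: $[e_1,x]=-[x,e_1]=e_1$; $[e_i,x]=-[x,e_i]=(i+1-n)e_i$ for $2\le i\le n-1$; $[e_n,x]=-[x,e_n]=2e_n$; $[x,x]=\delta_{n-1}e_{n-1}$. $R_5(b_2)$, with $b_2\notin\{1,\,5-n,\,3-n\}$: $[e_1,x]=-[x,e_1]=e_1$; $[e_i,x]=-[x,e_i]=(i-2+b_2)e_i$ for $2\le i\le n-1$; $[e_n,x]=-[x,e_n]=2e_n$.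
   Context: A Leibniz algebra is a complex vector space $L$ with a bilinear bracket satisfying $[u,[v,w]]=[[u,v],w]-[[u,w],v]$ for all $u,v,w$. Lower central series $L^1=L$, $L^{k+1}=[L^k,L]$; derived series $L^{[1]}=L$, $L^{[s+1]}=[L^{[s]},L^{[s]}]$; nilpotent/solvable means some term vanishes. The nilradical is the maximal nilpotent ideal. The Lie algebra $g^2_{(n,1)}$ has basis $\{e_1,\dots,e_n\}$ with nonzero brackets $[e_1,e_i]=-[e_i,e_1]=e_{i+1}$ for $2\le i\le n-2$ and $[e_i,e_n]=-[e_n,e_i]=e_{i+2}$ for $2\le i\le n-3$, all other brackets of basis elements being zero. *)

(* Defs.v *)
From HB Require Import structures.
From mathcomp Require Import all_boot all_order all_algebra.
From mathcomp Require Import complex.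
From mathcomp Require Import Rstruct.
Set Implicit Arguments. Unset Strict Implicit. Unset Printing Implicit Defensive.
Import Order.TTheory GRing.Theory Num.Theory.
Local Open Scope ring_scope.

Definition Cplx : fieldType := (Rdefinitions.R : rcfType)[i].

Section Leibniz.
Variable V : vectType Cplx.
Variable br : V -> V -> V.

Definition bilinear_br : Prop :=
  (forall (a : Cplx) u v w, br (a *: u + v) w = a *: br u w + br v w) /\
  (forall (a : Cplx) u v w, br w (a *: u + v) = a *: br w u + br w v).

Definition leibniz_identity : Prop :=
  forall u v w, br u (br v w) = br (br u v) w - br (br u w) v.

(* [A,B] : span of all brackets [a,b], a in A, b in B (by bilinearity it is
   the span of the brackets of basis vectors). *)
Definition brsp (A B : {vspace V}) : {vspace V} :=
  (\sum_(a <- vbasis A) \sum_(b <- vbasis B) <[br a b]>)%VS.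

Fixpoint lcs (I : {vspace V}) (k : nat) : {vspace V} :=
  if k is k'.+1 then brsp (lcs I k') I else I.

Fixpoint dser (I : {vspace V}) (s : nat) : {vspace V} :=
  if s is s'.+1 then brsp (dser I s') (dser I s') else I.

Definition is_ideal (I : {vspace V}) : Prop :=
  forall u v, u \in I -> br u v \in I /\ br v u \in I.

Definition nilpotent_sp (I : {vspace V}) : Prop := exists k, lcs I k = 0%VS.

Definition solvable_alg : Prop := exists s, dser fullv s = 0%VS.

Definition is_nilradical (N : {vspace V}) : Prop :=
  [/\ is_ideal N, nilpotent_sp N &
      forall J : {vspace V}, is_ideal J -> nilpotent_sp J -> (N <= J)%VS -> J = N].

Definition g2_table (n : nat) (e : nat -> V) (i j : nat) : V :=
  if (i == 1%N) && (2 <= j <= n - 2)%N then e j.+1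
  else if (j == 1%N) && (2 <= i <= n - 2)%N then - e i.+1
  else if (j == n) && (2 <= i <= n - 3)%N then e i.+2
  else if (i == n) && (2 <= j <= n - 3)%N then - e j.+2
  else 0.

Definition eseq (n : nat) (e : nat -> V) : seq V := mkseq (fun i => e i.+1) n.

Definition g2_basis (n : nat) (N : {vspace V}) (e : nat -> V) : Prop :=
  [/\ basis_of N (eseq n e) &
      forall i j, (1 <= i <= n)%N -> (1 <= j <= n)%N ->
        br (e i) (e j) = g2_table n e i j].

Definition isomorphic_to_g2 (n : nat) (N : {vspace V}) : Prop :=
  exists e : nat -> V, g2_basis n N e.

Definition xbrackets (n : nat) (e : nat -> V) (x : V) (f : nat -> V) (xx : V) : Prop :=
  (forall i, (1 <= i <= n)%N -> br (e i) x = f i /\ br x (e i) = - f i) /\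
  br x x = xx.

Definition typeR1 n e x : Prop :=
  exists b : nat -> Cplx,
    xbrackets n e x
      (fun i => if (2 <= i <= n - 1)%N then
                  e i + \sum_(i + 2 <= t < n) b (t - i + 2)%N *: e t
                else 0) 0.

Definition typeR2 n e x : Prop :=
  exists a2 : Cplx,
    xbrackets n e x
      (fun i => if i == 1%N then e 1%N + a2 *: e 2%N
                else if (2 <= i <= n - 1)%N then (i%:Z - 1)%:~R *: e i
                else - (a2 *: e 3%N) + 2%:R *: e n) 0.

Definition typeR3 n e x : Prop :=
  exists g : Cplx,
    xbrackets n e x
      (fun i => if i == 1%N then e 1%N
                else if (2 <= i <= n - 1)%N then (i%:Z + 3 - n%:Z)%:~R *: e i
                else g *: e (n - 1)%N + 2%:R *: e n) 0.

Definition typeR4 n e x : Prop :=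
  exists d : Cplx,
    xbrackets n e x
      (fun i => if i == 1%N then e 1%N
                else if (2 <= i <= n - 1)%N then (i%:Z + 1 - n%:Z)%:~R *: e i
                else 2%:R *: e n) (d *: e (n - 1)%N).

Definition typeR5 n e x : Prop :=
  exists b2 : Cplx,
    [/\ b2 != 1, b2 != (5 - n%:Z)%:~R, b2 != (3 - n%:Z)%:~R &
    xbrackets n e x
      (fun i => if i == 1%N then e 1%N
                else if (2 <= i <= n - 1)%N then ((i%:Z - 2)%:~R + b2) *: e i
                else 2%:R *: e n) 0].

End Leibniz.

(* Main.v *)
(* Write n = m + 2 and identify span(e_2, ..., e_(n-1)) with C[t]/t^m, so that
   e_1 acts as t and -e_n as t^2.  Then v |-> [v, x] is a derivation of the
   nilradical, and every derivation has the shape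
     e_1 |-> al e_1 + p,   e_n |-> 2 al e_n - t p + ka t^(m-1),
     f |-> al t f' + r f,
   with (al, r(0)) <> 0, for otherwise R itself would be nilpotent.  The
   elements [v, x] + [x, v] and [x, x] are annihilated from the left, hence
   are multiples of the central element t^(m-1); playing [x, t^(m-1)] against
   the weights al and r(0) kills all of them but possibly [x, x].
   The remaining freedom is: scaling x and shifting it by a e_1 + f (p changes
   by t f, r by -a t), multiplying C[t]/t^m by a unit u (r becomes r + al t u'/u),
   and e_1 += s, e_n += k t^(m-1) - s t.  If al = 0 this leads to R_1; if al = 1
   it makes r a constant b_2 and p a constant, and p, ka, [x, x] survive only for
   b_2 = 1, 5 - n, 3 - n respectively, which gives R_2, ..., R_5. *)
Require Import Defs.
From HB Require Import structures.
From mathcomp Require Import all_boot all_order all_algebra.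
From mathcomp Require Import complex Rstruct.
From mathcomp Require Import ring zify.
Import GRing.Theory.
Local Open Scope ring_scope.
Set Implicit Arguments.
Unset Strict Implicit.

(** * Polynomials in t, truncated at t^m *)

Lemma natCplx_neq0 (k : nat) : (0 < k)%N -> (k%:R : Cplx) != 0.
Proof.
(* Characteristic zero comes from the numeric structure of [complex Rdefinitions.R], which the bare
   [fieldType] [Cplx] hides; the two equality tests are then matched by conversion. *)
move=> k0; have := @Num.Theory.pnatr_eq0 (complex Rdefinitions.R) k.
by move/negbT: (gtn_eqF k0) => kn0 E; apply/negP; rewrite [_ == _]E; apply/negP.
Qed.

Lemma poly_headX (F : comNzRingType) (f : {poly F}) :
  exists g : {poly F}, f = (f`_0)%:P + 'X * g.
Proof.
elim/poly_ind: f => [|f c _]; first by exists 0; rewrite coef0 mulr0 addr0.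
by exists f; rewrite coefD coefMX coefC /= add0r addrC mulrC.
Qed.

(** The inverse of 1 + t w is the geometric series in - t w, cut after m terms; what is left over is
    (- t w)^m up to sign, a multiple of t^m. *)
Lemma mulX_inv_mod (F : comNzRingType) (w : {poly F}) (m : nat) :
  exists v z : {poly F}, (1 + 'X * w) * v = 1 + 'X^m * z.
Proof.
pose y := - ('X * w).
exists (\sum_(i < m) y ^+ i); exists (- (- w) ^+ m).
have := subrX1 y m; set S := \sum_(i < m) _ => E.
have -> : (1 + 'X * w) * S = - (y ^+ m - 1) by rewrite E /y; ring.
by rewrite /y -mulrN exprMn opprB mulrN.
Qed.

(* Truncated at t^m, u = 1 + t w solves t u' + r u = r(0) u. *)
Lemma euler_solution (F : fieldType) (r : {poly F}) (m : nat) :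
  (forall k, (0 < k)%N -> k%:R != 0 :> F) -> (0 < m)%N ->
  exists w z : {poly F}, 'X * (1 + 'X * w)^`() + r * (1 + 'X * w) =
    (r`_0)%:P * (1 + 'X * w) + 'X^m * z.
Proof.
move=> charF; have [g Er] := poly_headX r; case: m => // m _.
elim: m => [|m [w [z E]]].
  by exists 0; exists g; rewrite mulr0 addr0 -[1]polyC1 derivC {1}Er; ring.
have [z1 Ez] := poly_headX z.
(* Induction on the precision: adding c t^(m+1) to u changes the leading error coefficient z(0) by
   (m+1) c, so c is chosen to cancel it. *)
have [c Ec] : exists c : F, c%:P * m.+1%:R = - (z`_0)%:P :> {poly F}.
  exists (- (z`_0 / m.+1%:R)).
  by rewrite -polyC_natr -polyCM -polyCN mulNr divfK ?charF.
exists (w + c%:P * 'X^m); exists (z1 + c%:P * g).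
have -> : 1 + 'X * (w + c%:P * 'X^m) = (1 + 'X * w) + c%:P * 'X^(m.+1).
  by rewrite exprS; ring.
rewrite derivD deriv_mulC derivXn -[_ *+ _]mulr_natr.
rewrite [m.+1.-1]/= !exprS in E *.
move: E Ec Er Ez; move: (1 + _) => u; move: (u^`()) m.+1%:R ('X^m) => u' M Xm.
move: (r`_0)%:P (z`_0)%:P c%:P => r0 z0 C E Ec Er Ez.
have -> : 'X * (u' + C * (Xm * M)) + r * (u + C * ('X * Xm)) =
  ('X * u' + r * u) + 'X * Xm * (C * M) + r * C * ('X * Xm) by ring.
by rewrite E Ec Ez Er; ring.
Qed.

(** * Bilinear brackets and polynomial coordinates on the nilradical *)

Section Leibniz.
Variables (V : vectType Cplx) (br : V -> V -> V).
Hypothesis bil : bilinear_br br.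
Implicit Types (N : {vspace V}) (P : {linear {poly Cplx} -> V}).
Implicit Types (f g p r : {poly Cplx}) (a b c : Cplx).

Lemma brDl u v w : br (u + v) w = br u w + br v w.
Proof. by have := bil.1 1 u v w; rewrite !scale1r. Qed.
Lemma brDr u v w : br w (u + v) = br w u + br w v.
Proof. by have := bil.2 1 u v w; rewrite !scale1r. Qed.
Lemma br0l w : br 0 w = 0.
Proof. by apply: (addrI (br 0 w)); rewrite -brDl !addr0. Qed.
Lemma br0r w : br w 0 = 0.
Proof. by apply: (addrI (br w 0)); rewrite -brDr !addr0. Qed.
Lemma brZl a u w : br (a *: u) w = a *: br u w.
Proof. by have := bil.1 a u 0 w; rewrite br0l !addr0. Qed.
Lemma brZr a u w : br w (a *: u) = a *: br w u.
Proof. by have := bil.2 a u 0 w; rewrite br0r !addr0. Qed.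
Lemma brNl u w : br (- u) w = - br u w.
Proof. by rewrite -scaleN1r brZl scaleN1r. Qed.
Lemma brNr u w : br w (- u) = - br w u.
Proof. by rewrite -scaleN1r brZr scaleN1r. Qed.
Lemma br_suml (I : Type) (s : seq I) (Q : pred I) (F : I -> V) w :
  br (\sum_(i <- s | Q i) F i) w = \sum_(i <- s | Q i) br (F i) w.
Proof. by apply: (big_morph (br^~ w)) => [u v|]; rewrite ?brDl ?br0l. Qed.
Lemma br_sumr (I : Type) (s : seq I) (Q : pred I) (F : I -> V) w :
  br w (\sum_(i <- s | Q i) F i) = \sum_(i <- s | Q i) br w (F i).
Proof. by apply: (big_morph (br w)) => [u v|]; rewrite ?brDr ?br0r. Qed.
Definition brE := (brDl, brDr, brZl, brZr, brNl, brNr).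

Lemma lin_scale P c f : c *: P f = P (c%:P * f).
Proof. by rewrite mul_polyC linearZ. Qed.
Lemma lin_opp P f : - P f = P (- f).
Proof. by rewrite linearN. Qed.
Lemma lin_add P f g : P f + P g = P (f + g).
Proof. by rewrite linearD. Qed.

(** Elements of the nilradical are handled in this form, so that identities between brackets become
    polynomial identities; in a frame, [f] matters only modulo t^m. *)
Definition nvec (e1 en : V) P a b f : V := a *: e1 + b *: en + P f.

Section Nvec.
Variables (e1 en : V) (P : {linear {poly Cplx} -> V}).
Notation vec := (nvec e1 en P).

Lemma vecD a b f a' b' f' :
  vec a b f + vec a' b' f' = vec (a + a') (b + b') (f + f').
Proof. by rewrite /nvec linearD !scalerDl addrACA [X in X + _]addrACA. Qed.
Lemma vecZ c a b f : c *: vec a b f = vec (c * a) (c * b) (c%:P * f).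
Proof. by rewrite /nvec !scalerDr !scalerA mul_polyC linearZ. Qed.
Lemma vecN a b f : - vec a b f = vec (- a) (- b) (- f).
Proof. by rewrite /nvec linearN !scaleNr !opprD. Qed.
Lemma vecB a b f a' b' f' :
  vec a b f - vec a' b' f' = vec (a - a') (b - b') (f - f').
Proof. by rewrite vecN vecD. Qed.
Lemma vec_e1 : e1 = vec 1 0 0.
Proof. by rewrite /nvec scale1r scale0r linear0 !addr0. Qed.
Lemma vec_en : en = vec 0 1 0.
Proof. by rewrite /nvec scale1r scale0r linear0 addr0 add0r. Qed.
Lemma vec_P f : P f = vec 0 0 f.
Proof. by rewrite /nvec !scale0r !add0r. Qed.
Lemma vec_eq a b f a' b' f' : a = a' -> b = b' -> f = f' ->
  vec a b f = vec a' b' f'.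
Proof. by move=> -> -> ->. Qed.
End Nvec.

(* The span of e_2, ..., e_(n-1) is identified with C[t]/t^m, m = n - 2, via
   e_(k+2) = t^k: then e_1 acts as t and -e_n as t^2. *)
Record g2_frame N (m : nat) e1 en P : Prop := G2Frame {
  frame_br : forall a b f a' b' f',
    br (nvec e1 en P a b f) (nvec e1 en P a' b' f') =
    P ((a%:P * 'X - b%:P * 'X^2) * f' - (a'%:P * 'X - b'%:P * 'X^2) * f);
  frame_Xm : forall f, P ('X^m * f) = 0;
  frame_mem : forall v,
    v \in N <-> exists a b f, v = nvec e1 en P a b f }.

(** Kept apart from [g2_frame]: freeness is established for the frame of the given basis only, while
    after a change of frame independence follows from the dimension of [N]. *)
Definition frame_free (m : nat) e1 en P : Prop := forall a b f,
  nvec e1 en P a b f = 0 -> [/\ a = 0, b = 0 & forall k, (k < m)%N -> f`_k = 0].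

Lemma frame_intro N m e1 en P :
  br e1 en = 0 -> br en e1 = 0 -> br e1 e1 = 0 -> br en en = 0 ->
  (forall f, br e1 (P f) = P ('X * f)) ->
  (forall f, br (P f) e1 = - P ('X * f)) ->
  (forall f, br (P f) en = P ('X^2 * f)) ->
  (forall f, br en (P f) = - P ('X^2 * f)) ->
  (forall f g, br (P f) (P g) = 0) ->
  (forall f, P ('X^m * f) = 0) ->
  (forall v, v \in N <-> exists a b f, v = nvec e1 en P a b f) ->
  g2_frame N m e1 en P.
Proof.
move=> h1 h2 h3 h4 h5 h6 h7 h8 h9 hX hN; split=> // a b f a' b' f'.
rewrite /nvec !brE h1 h2 h3 h4 !h5 !h6 !h7 !h8 h9 !scaler0 !addr0 !add0r.
by rewrite !(lin_scale, lin_opp, lin_add); congr (P _); ring.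
Qed.

(** * From a basis with the brackets of $g^2_{(n,1)}$ to a frame *)

Section FromBasis.
Variables (m : nat) (e : nat -> V).

(** Ignoring the coefficients from degree m on makes multiples of t^m vanish without forming the
    quotient C[t]/t^m. *)
Definition coef_comb f : V := \sum_(k < m) f`_k *: e k.+2.
Fact coef_comb_linear : linear coef_comb.
Proof.
move=> a f g; rewrite /coef_comb scaler_sumr -big_split /=.
by apply: eq_bigr => k _; rewrite coefD coefZ scalerDl scalerA.
Qed.
HB.instance Definition _ :=
  GRing.isLinear.Build Cplx {poly Cplx} V _ coef_comb coef_comb_linear.

Lemma coef_combX f :
  coef_comb ('X * f) = \sum_(k < m.-1) f`_k *: e k.+3.
Proof.
rewrite /coef_comb; case: m => [|m']; first by rewrite !big_ord0.
rewrite big_ord_recl coefXM /= scale0r add0r.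
by apply: eq_bigr => k _; rewrite coefXM.
Qed.

Lemma coef_combX2 f :
  coef_comb ('X^2 * f) = \sum_(k < m.-2) f`_k *: e k.+4.
Proof.
rewrite expr2 -mulrA coef_combX; case: m => [|[|m']] /=; rewrite ?big_ord0 //.
rewrite big_ord_recl coefXM /= scale0r add0r.
by apply: eq_bigr => k _; rewrite coefXM.
Qed.

Variable N : {vspace V}.
Hypothesis eN : g2_basis br m.+2 N e.
Hypothesis m2 : (1 < m)%N.

Let size_e : size (eseq m.+2 e) == m.+2. Proof. by rewrite size_mkseq. Qed.
Let nth_e (i : 'I_m.+2) : (eseq m.+2 e)`_i = e i.+1.
Proof. by rewrite nth_mkseq. Qed.

Lemma coef_combE (c : nat -> Cplx) :
  \sum_(i < m.+2) c i *: e i.+1 =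
  nvec (e 1) (e m.+2) coef_comb (c 0) (c m.+1) (\poly_(k < m) c k.+1).
Proof.
rewrite big_ord_recl big_ord_recr /= addrA addrAC /nvec; congr (_ + _).
by apply: eq_bigr => i _; rewrite coef_poly ltn_ord.
Qed.

Lemma g2_basis_frame : g2_frame N m (e 1) (e m.+2) coef_comb.
Proof.
case: eN => bN eT; apply: frame_intro.
- by rewrite eT // /g2_table /=; repeat case: ifP => //; lia.
- by rewrite eT // /g2_table /=; repeat case: ifP => //; lia.
- by rewrite eT // /g2_table /=; repeat case: ifP => //; lia.
- by rewrite eT // /g2_table /=; repeat case: ifP => //; lia.
- move=> f /=; rewrite coef_combX br_sumr.
  (* Multiplication by t pushes the last coefficient out, leaving m - 1 terms; the sum is padded to
     m terms to be compared with the table term by term. *)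
  rewrite (big_ord_widen m (fun k => f`_k *: e k.+3)) ?leq_pred // [RHS]big_mkcond.
  apply: eq_bigr => k _; have km := ltn_ord k; rewrite brZr eT; [|lia..].
  by rewrite /g2_table /=; repeat case: ifP; rewrite ?scaler0 //; lia.
- move=> f /=; rewrite coef_combX br_suml -sumrN.
  rewrite (big_ord_widen m (fun k => - (f`_k *: e k.+3))) ?leq_pred //.
  rewrite [RHS]big_mkcond; apply: eq_bigr => k _; have km := ltn_ord k.
  rewrite brZl eT; [|lia..].
  by rewrite /g2_table /=; repeat case: ifP; rewrite ?scaler0 ?scalerN //; lia.
- move=> f /=; rewrite coef_combX2 br_suml.
  rewrite (big_ord_widen m (fun k => f`_k *: e k.+4)); last by lia.
  rewrite [RHS]big_mkcond; apply: eq_bigr => k _; have km := ltn_ord k.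
  rewrite brZl eT; [|lia..].
  by rewrite /g2_table /=; repeat case: ifP; rewrite ?scaler0 ?scalerN //; lia.
- move=> f /=; rewrite coef_combX2 br_sumr -sumrN.
  rewrite (big_ord_widen m (fun k => - (f`_k *: e k.+4))); last by lia.
  rewrite [RHS]big_mkcond; apply: eq_bigr => k _; have km := ltn_ord k.
  rewrite brZr eT; [|lia..].
  by rewrite /g2_table /=; repeat case: ifP; rewrite ?scaler0 ?scalerN //; lia.
- move=> f g /=; rewrite /coef_comb br_suml big1 // => k _.
  rewrite br_sumr big1 // => l _; have km := ltn_ord k; have lm := ltn_ord l.
  rewrite brZl brZr eT; [|lia..].
  by rewrite /g2_table /=; repeat case: ifP; rewrite ?scaler0 //; lia.
- move=> f /=; rewrite /coef_comb big1 // => k _.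
  by rewrite coefXnM ltn_ord scale0r.
- move=> v; split=> [vN | [a [b [f ->]]]]; last first.
    have eX : {subset eseq m.+2 e <= N}.
      by move=> w we; rewrite -(span_basis bN) memv_span.
    have eI i : (0 < i <= m.+2)%N -> e i \in N.
      move=> iP; apply: eX; apply/mapP; exists i.-1; rewrite ?mem_iota; try lia.
      by rewrite prednK //; lia.
    rewrite /nvec !rpredD ?rpredZ ?eI //; try lia.
    by apply: rpred_sum => k _; rewrite rpredZ ?eI //; have := ltn_ord k; lia.
  pose X := Tuple size_e.
  have := @coord_span _ _ _ X v; rewrite (span_basis bN) => /(_ vN) ->.
  pose c k := if insub k is Some i then coord X i v else 0.
  exists (c 0), (c m.+1), (\poly_(k < m) c k.+1); rewrite -coef_combE.
  by apply: eq_bigr => i _; rewrite nth_e /c valK.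
Qed.

Lemma g2_basis_free : frame_free m (e 1) (e m.+2) coef_comb.
Proof.
move=> a b f v0; have /basis_free/(@freeP _ _ _ (Tuple size_e)) fe := eN.1.
pose c k := if k == 0%N then a else if k == m.+1 then b else f`_k.-1.
have : nvec (e 1) (e m.+2) coef_comb (c 0) (c m.+1) (\poly_(k < m) c k.+1) = 0.
  rewrite -[RHS]v0 /c /= eqxx; congr (_ + _).
  apply: eq_bigr => k _; rewrite coef_poly ltn_ord; case: eqP => //.
  by have := ltn_ord k; lia.
rewrite -coef_combE => sum0.
have {}fe i : (i < m.+2)%N -> c i = 0.
  move=> im; apply: (fe (fun i => c i) _ (Ordinal im)).
  by rewrite -[RHS]sum0; apply: eq_bigr => j _; rewrite nth_e.
split=> [||k km]; first exact: (fe 0%N).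
  by have := fe m.+1 (leqnn _); rewrite /c eqxx.
by have := fe k.+1; rewrite /c /= eqSS ltn_eqF // => -> //; lia.
Qed.

End FromBasis.

Lemma poly_low_coef0 (F : comNzRingType) (k : nat) (g : {poly F}) :
  (forall i, (i < k)%N -> g`_i = 0) ->
  exists h : {poly F}, g = (g`_k)%:P * 'X^k + 'X^(k.+1) * h.
Proof.
move=> g0; have Eg : g = drop_poly k g * 'X^k.
  rewrite -{1}(poly_take_drop k g) [take_poly _ _](_ : _ = 0) ?add0r //.
  by apply/polyP=> i; rewrite coef_poly coef0; case: ltnP => // /g0.
have [h Eh] := poly_headX (drop_poly k g); exists h.
by rewrite {1}Eg {1}Eh coef_drop_poly exprS; ring.
Qed.

Section Frame.
Variables (N : {vspace V}) (m : nat) (e1 en : V) (P : {linear {poly Cplx} -> V}).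
Hypothesis fr : g2_frame N m e1 en P.
Notation vec := (nvec e1 en P).

Lemma vec_br a b f a' b' f' : br (vec a b f) (vec a' b' f') =
  vec 0 0 ((a%:P * 'X - b%:P * 'X^2) * f' - (a'%:P * 'X - b'%:P * 'X^2) * f).
Proof. by rewrite (frame_br fr) -vec_P. Qed.

(** Calculation modulo t^m: giving the quotient [h] explicitly turns a congruence into an identity
    for [ring]. *)
Lemma vec_mod a b f f' h : f = f' + 'X^m * h -> vec a b f = vec a b f'.
Proof. by move=> ->; rewrite /nvec linearD (frame_Xm fr) addr0. Qed.

Lemma vec_in a b f : vec a b f \in N.
Proof. by apply/(frame_mem fr); exists a, b, f. Qed.

End Frame.

(** These parameters are what the changes of basis below act on: al and r(0) are the weights of x,
    while p, [ka] and [de] are the terms to be removed when the weights allow it. *)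
Record x_action N m e1 en P (x : V) (al : Cplx) p r (ka de : Cplx) : Prop :=
  XAction {
  act_br : forall a b f, br (nvec e1 en P a b f) x =
    nvec e1 en P (al * a) (2%:R * al * b)
      (a%:P * p + b%:P * (ka%:P * 'X^(m.-1) - 'X * p)
       + al%:P * 'X * f^`() + r * f);
  act_anti : forall v, v \in N -> br x v = - br v x;
  act_sq : br x x = P (de%:P * 'X^(m.-1));
  act_out : x \notin N }.

(** * Derivations of the nilradical *)

Section Derivation.
Variables (N : {vspace V}) (m : nat) (e1 en : V) (P : {linear {poly Cplx} -> V}).
Hypothesis fr : g2_frame N m e1 en P.
Hypothesis fe : frame_free m e1 en P.
Hypothesis m4 : (3 < m)%N.
Notation vec := (nvec e1 en P).

(** D is determined by its values on e_1, e_n and 1, because e_1 generates every t^k from 1. The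
    relations [1, t] = 0, [e_1, t] = [1, e_n] and [e_1, e_n] = 0 constrain these three values. *)
Lemma derivation_form (D : V -> V) :
  (forall c u v, D (c *: u + v) = c *: D u + D v) ->
  (forall u v, D (br u v) = br (D u) v + br u (D v)) ->
  (forall v, v \in N -> D v \in N) ->
  exists al p r ka, forall a b f, D (vec a b f) =
    vec (al * a) (2%:R * al * b)
      (a%:P * p + b%:P * (ka%:P * 'X^(m.-1) - 'X * p)
       + al%:P * 'X * f^`() + r * f).
Proof.
move=> Dlin Dbr DN.
have D0 : D 0 = 0 by have := Dlin (-1) 0 0; rewrite !scaleN1r !addNr.
have DD u v : D (u + v) = D u + D v by have := Dlin 1 u v; rewrite !scale1r.
have DZ c u : D (c *: u) = c *: D u by have := Dlin c u 0; rewrite D0 !addr0.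
have v0 : vec 0 0 0 = 0 by rewrite /nvec !scale0r linear0 !addr0.
have getv v : v \in N -> exists a b f, v = vec a b f by move/(frame_mem fr).
have [al [be [p E1]]] := getv _ (DN _ (vec_in fr 1 0 0)).
have [ga [ep [q En]]] := getv _ (DN _ (vec_in fr 0 1 0)).
have [la [mu [r E2]]] := getv _ (DN _ (vec_in fr 0 0 1)).
have free0 f k : vec 0 0 f = 0 -> (k < m)%N -> f`_k = 0.
  by case/fe => _ _; apply.
have EX : D (vec 0 0 'X) = vec 0 0 (al%:P * 'X - be%:P * 'X^2 + 'X * r).
  have -> : vec 0 0 'X = br (vec 1 0 0) (vec 0 0 1).
    by rewrite (vec_br fr); apply: vec_eq => //; ring.
  by rewrite Dbr E1 E2 !(vec_br fr) vecD; apply: vec_eq; ring.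
have PPX : br (vec 0 0 1) (vec 0 0 'X) = 0.
  by rewrite (vec_br fr) -[RHS]v0; apply: vec_eq; ring.
(* Applying D to [1, t] = 0 shows that D(1) has no component along e_1 or e_n; reading the
   coefficient of t^3 takes m > 3. *)
have := Dbr (vec 0 0 1) (vec 0 0 'X).
rewrite PPX D0 E2 EX !(vec_br fr) vecD => /esym E12.
have {}E12 : vec 0 0 (la%:P * 'X^2 - mu%:P * 'X^3) = 0.
  by rewrite -[RHS]E12; apply: vec_eq; ring.
have la0 : la = 0.
  have := free0 _ 2%N E12; rewrite coefB !coefCM !coefXn /= mulr1 mulr0 subr0.
  by apply; lia.
have mu0 : mu = 0.
  have := free0 _ 3%N E12; rewrite coefB !coefCM !coefXn /= mulr1 mulr0 sub0r.
  by move=> /(_ m4)/eqP; rewrite oppr_eq0 => /eqP.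
move: E2; rewrite {}la0 {}mu0 => E2.
have EX2 : D (vec 0 0 'X^2) =
    vec 0 0 (2%:R * al%:P * 'X^2 - 2%:R * be%:P * 'X^3 + 'X^2 * r).
  have -> : vec 0 0 'X^2 = br (vec 1 0 0) (vec 0 0 'X).
    by rewrite (vec_br fr); apply: vec_eq => //; ring.
  by rewrite Dbr E1 EX !(vec_br fr) vecD; apply: vec_eq; ring.
(* Since t^2 is both [e_1, t] and [1, e_n], its two images under D must agree, which ties D(e_n) to
   D(e_1). *)
have Een : vec 0 0 (ga%:P * 'X + (2%:R * al - ep)%:P * 'X^2
                    - (2%:R * be)%:P * 'X^3) = 0.
  have EX2' : vec 0 0 'X^2 = br (vec 0 0 1) (vec 0 1 0).
    by rewrite (vec_br fr); apply: vec_eq => //; ring.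
  have := EX2; rewrite {1}EX2' Dbr E2 En !(vec_br fr) vecD => /esym/eqP.
  rewrite -subr_eq0 vecB => /eqP <-; apply: vec_eq; ring.
have ga0 : ga = 0.
  have := free0 _ 1%N Een.
  rewrite coefB coefD !coefCM !coefXn coefX /= mulr1 !mulr0 addr0 subr0.
  by apply; lia.
have ep2 : ep = 2%:R * al.
  have := free0 _ 2%N Een.
  rewrite coefB coefD !coefCM !coefXn coefX /= mulr1 !mulr0 add0r subr0.
  by move=> h; apply/esym/eqP; rewrite -subr_eq0 h //; lia.
have be0 : be = 0.
  have := free0 _ 3%N Een.
  rewrite coefB coefD !coefCM !coefXn coefX /= mulr1 !mulr0 !add0r.
  move=> /(_ m4)/eqP; rewrite oppr_eq0 mulf_eq0 (negPf (@natCplx_neq0 2 _)) //=.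
  by move=> /eqP.
have EP f : D (vec 0 0 f) = vec 0 0 (al%:P * 'X * f^`() + r * f).
  elim/poly_ind: f => [|f c IH]; first by rewrite deriv0 !mulr0 addr0 v0 D0.
  have -> : vec 0 0 (f * 'X + c%:P) =
      c *: vec 0 0 1 + br (vec 1 0 0) (vec 0 0 f).
    by rewrite vecZ (vec_br fr) vecD; apply: vec_eq; ring.
  rewrite DD DZ Dbr IH E1 E2 !(vec_br fr) vecZ !vecD derivMXaddC be0.
  by apply: vec_eq; ring.
(* From [e_1, e_n] = 0, t (q + t p) vanishes modulo t^m, so only the coefficient of t^(m-1) in q + t
   p stays free: this is [ka]. *)
have Eq0 k : (k < m.-1)%N -> (q + 'X * p)`_k = 0.
  move=> km; have := Dbr (vec 1 0 0) (vec 0 1 0).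
  have -> : br (vec 1 0 0) (vec 0 1 0) = 0.
    by rewrite (vec_br fr) -[RHS]v0; apply: vec_eq; ring.
  rewrite D0 E1 En !(vec_br fr) vecD => /esym E0.
  have {}E0 : vec 0 0 ('X * (q + 'X * p)) = 0.
    by rewrite -[RHS]E0; apply: vec_eq; ring.
  by have := free0 _ k.+1 E0; rewrite coefXM; apply; lia.
have [h Eh] := poly_low_coef0 Eq0.
exists al, p, r, ((q + 'X * p)`_m.-1) => a b f.
have -> : vec a b f = a *: vec 1 0 0 + b *: vec 0 1 0 + vec 0 0 f.
  by rewrite !vecZ !vecD; apply: vec_eq; ring.
rewrite (DD _ (vec 0 0 f)) (DD (a *: _)) !DZ E1 En EP !vecZ !vecD be0 ga0 ep2.
rewrite prednK in Eh; last lia.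
set ka := _`_m.-1 in Eh *.
have Eq : q = ka%:P * 'X^(m.-1) - 'X * p + 'X^m * h.
  by rewrite -[q](addrK ('X * p)) Eh; ring.
rewrite (vec_mod fr _ _ (h := b%:P * h) (f' := a%:P * p + b%:P * (ka%:P * 'X^(m.-1) - 'X * p)
       + al%:P * 'X * f^`() + r * f)).
  by apply: vec_eq => //; ring.
by rewrite Eq; ring.
Qed.
End Derivation.

End Leibniz.

(** * Nilpotency for zero weights, and left multiplication by x *)

Section Structure.
Variables (V : vectType Cplx) (br : V -> V -> V).
Implicit Types (f g p r : {poly Cplx}) (a b c : Cplx).

Lemma memv_sum_ind (I : eqType) (s : seq I) (F : I -> {vspace V})
    (S : V -> Prop) :
  S 0 -> (forall u v, S u -> S v -> S (u + v)) ->
  (forall i v, i \in s -> v \in F i -> S v) ->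
  forall v, v \in (\sum_(i <- s) F i)%VS -> S v.
Proof.
move=> S0 SD; elim: s => [|i s IH] SF v.
  by rewrite big_nil memv0 => /eqP->.
rewrite big_cons => /memv_addP[u ui [w ws ->]]; apply: SD.
  by apply: SF ui; rewrite mem_head.
by apply: IH ws => j z js; apply: SF; rewrite in_cons js orbT.
Qed.

Lemma brsp_ind (S : V -> Prop) (A B : {vspace V}) :
  S 0 -> (forall u v, S u -> S v -> S (u + v)) ->
  (forall c u, S u -> S (c *: u)) ->
  (forall u v, u \in A -> v \in B -> S (br u v)) ->
  forall v, v \in brsp br A B -> S v.
Proof.
move=> S0 SD SZ SB; apply: memv_sum_ind => // u v uA.
apply: memv_sum_ind => // w z wB /vlineP[c ->].
by apply/SZ/SB; apply: vbasis_mem.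
Qed.

Hypothesis bil : bilinear_br br.
Variables (N : {vspace V}) (m : nat) (e1 en : V).
Variable (P : {linear {poly Cplx} -> V}).
Hypothesis fr : g2_frame br N m e1 en P.
Notation vec := (nvec e1 en P).
Variables (x : V) (al : Cplx) (p r : {poly Cplx}) (ka : Cplx).
Hypothesis Dx : forall a b f, br (vec a b f) x =
    vec (al * a) (2%:R * al * b)
      (a%:P * p + b%:P * (ka%:P * 'X^(m.-1) - 'X * p)
       + al%:P * 'X * f^`() + r * f).

(** With both weights zero, right multiplication by any element raises the order in t. The lower
    central series enters the polynomial part after two steps and then gains a factor t at each
    step. *)
Lemma nilpotent_full :
  (forall v, exists2 w, w \in N & exists c, v = w + c *: x) ->
  (forall u v, br u v \in N) ->
  al = 0 -> r`_0 = 0 -> nilpotent_sp br fullv.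
Proof.
move=> dec brN al0 r0; have [g Er] := poly_headX r.
have Pdec v : exists a b f c, v = vec a b f + c *: x.
  have [w /(frame_mem fr)[a [b [f ->]]] [c ->]] := dec v.
  by exists a, b, f, c.
have W k v : v \in lcs br fullv k.+2 -> exists f, v = vec 0 0 ('X^k * f).
  elim: k v => [|k IH]; apply: brsp_ind.
  - by exists 0; rewrite mulr0 /nvec !scale0r linear0 !addr0.
  - move=> _ _ [f ->] [f' ->]; exists (f + f').
    by rewrite vecD; apply: vec_eq; ring.
  - by move=> c _ [f ->]; exists (c%:P * f); rewrite vecZ; apply: vec_eq; ring.
  - move=> u v uL _; have {uL} : u \in N.
      apply: (brsp_ind (S := fun u => u \in N)) uL => // [|u1 u2|c u1]; rewrite ?mem0v //.
        exact: rpredD.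
      exact: rpredZ.
    move/(frame_mem fr)=> [a [b [f ->]]]; have [a' [b' [f' [c ->]]]] := Pdec v.
    rewrite (brDr bil) (brZr bil) Dx (vec_br fr) vecZ vecD al0.
    by eexists; rewrite expr0 mul1r; apply: vec_eq; [ring | ring | reflexivity].
  - by exists 0; rewrite mulr0 /nvec !scale0r linear0 !addr0.
  - move=> _ _ [f ->] [f' ->]; exists (f + f').
    by rewrite vecD; apply: vec_eq; ring.
  - by move=> c _ [f ->]; exists (c%:P * f); rewrite vecZ; apply: vec_eq; ring.
  - move=> u v /IH[f ->] _; have [a' [b' [f' [c ->]]]] := Pdec v.
    rewrite (brDr bil) (brZr bil) Dx (vec_br fr) vecZ vecD al0.
    exists (c%:P * g * f - (a'%:P - b'%:P * 'X) * f).
    apply: vec_eq; [ring | ring |].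
    by rewrite {1}Er r0 [in 'X^(k.+1)]exprS; ring.
exists m.+2; apply/eqP; rewrite -subv0; apply/subvP=> v /W[f ->].
by rewrite /nvec !scale0r !add0r (frame_Xm fr) mem0v.
Qed.

Hypothesis lei : leibniz_identity br.
Hypothesis fe : frame_free m e1 en P.
Hypothesis m3 : (2 < m)%N.
Hypothesis idN : is_ideal br N.
Hypothesis xxN : br x x \in N.
Hypothesis ndeg : al != 0 \/ r`_0 != 0.

(** The vector e_(n-1), which spans the center of the nilradical. *)
Let Z := vec 0 0 'X^(m.-1).

Lemma top_neq0 : Z != 0.
Proof.
apply/eqP=> /fe[_ _ /(_ m.-1)]; rewrite coefXn eqxx => h.
by have /eqP := h ltac:(lia); rewrite oner_eq0.
Qed.

Let Xm : 'X^m = 'X^(m.-1) * 'X :> {poly Cplx}.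
Proof. by rewrite -exprSr prednK //; lia. Qed.

Lemma br_top v : v \in N -> br Z v = 0.
Proof.
move/(frame_mem fr)=> [a [b [f ->]]].
rewrite /Z (vec_br fr) (vec_mod fr _ _ (f' := 0) (h := - (a%:P - b%:P * 'X))).
  by rewrite /nvec !scale0r linear0 !addr0.
by rewrite Xm; ring.
Qed.

(** On t^(m-1) the operator al t d/dt contributes (m - 1) al, and only the constant term of r
    survives modulo t^m. *)
Lemma top_x : br Z x = ((m.-1)%:R * al + r`_0) *: Z.
Proof.
have [g Er] := poly_headX r.
rewrite /Z Dx vecZ (vec_mod fr _ _ (h := g)
  (f' := ((m.-1)%:R * al + r`_0)%:P * 'X^(m.-1))).
  by apply: vec_eq => //; ring.
have -> : ('X^(m.-1))^`() = (m.-1)%:R%:P * 'X^(m.-2) :> {poly Cplx}.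
  by rewrite derivXn -mulr_natl polyC_natr.
have E : 'X^(m.-1) = 'X * 'X^(m.-2) :> {poly Cplx}.
  by rewrite -exprS prednK //; lia.
by rewrite Xm E {1}Er; ring.
Qed.

(** Bracketing with 1 removes the components along e_1 and e_n; bracketing with e_1 then removes
    every coefficient below t^(m-1). *)
Lemma top_unique z : z \in N -> (forall u, u \in N -> br u z = 0) ->
  exists c, z = c *: Z.
Proof.
move/(frame_mem fr)=> [a [b [f ->]]] h.
have /fe[_ _ h1] : vec 0 0 (b%:P * 'X^2 - a%:P * 'X) = 0.
  rewrite -[RHS](h _ (vec_in fr 0 0 1)) (vec_br fr).
  by apply: vec_eq => //; ring.
have /fe[_ _ h2] : vec 0 0 ('X * f) = 0.
  rewrite -[RHS](h _ (vec_in fr 1 0 0)) (vec_br fr).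
  by apply: vec_eq => //; ring.
have a0 : a = 0.
  have := h1 1%N ltac:(lia); rewrite coefB !coefCM coefXn coefX /= mulr0 mulr1 sub0r.
  by move/eqP; rewrite oppr_eq0 => /eqP.
have /poly_low_coef0[q Eq] k : (k < m.-1)%N -> f`_k = 0.
  by move=> km; have := h2 k.+1; rewrite coefXM; apply; lia.
have b0 : b = 0.
  have := h1 _ m3; rewrite coefB !coefCM coefXn coefX /= mulr0 mulr1 subr0.
  by [].
rewrite prednK in Eq; last by lia.
exists f`_m.-1; rewrite /Z vecZ a0 b0 (vec_mod fr _ _ Eq).
by apply: vec_eq; ring.
Qed.

Let anti v := br v x + br x v.

Let anti_lin c u v : anti (c *: u + v) = c *: anti u + anti v.
Proof.
by rewrite /anti !(brE bil) scalerDr addrACA.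
Qed.

(** Exchanging v and x changes the sign of the right-hand side of the Leibniz identity, so [u,
    [v, x]] and [u, [x, v]] are opposite. *)
Let anti_ann u v : br u (anti v) = 0.
Proof.
by rewrite /anti (brDr bil) !lei addrC addrA subrK subrr.
Qed.

Let anti_top v : v \in N -> exists c, anti v = c *: Z.
Proof.
move=> vN; apply: top_unique => [|u _]; last exact: anti_ann.
by have [? ?] := idN x vN; rewrite rpredD.
Qed.

(** On [N], left multiplication by x is minus right multiplication up to multiples of [Z], which
    bracket to zero with [N]; the derivation rule cancels the rest. *)
Let anti_br u v : u \in N -> v \in N -> anti (br u v) = 0.
Proof.
move=> uN vN; have [c Ec] := anti_top uN; have [d Ed] := anti_top vN.
have Eu : br x u = c *: Z - br u x by rewrite -Ec /anti addrC addKr.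
have Ev : br x v = d *: Z - br v x by rewrite -Ed /anti addrC addKr.
have Nsym w z : w \in N -> z \in N -> br w z = - br z w.
  move=> /(frame_mem fr)[a [b [f ->]]] /(frame_mem fr)[a' [b' [f' ->]]].
  by rewrite !(vec_br fr) vecN; apply: vec_eq; ring.
have [uxN _] := idN x uN; have [vxN _] := idN x vN.
have E1 : br (br u v) x = br (br u x) v + br u (br v x) by rewrite lei addrC subrK.
rewrite /anti E1 (lei x u v) Eu Ev (brDl bil (c *: Z)) (brDl bil (d *: Z)).
rewrite !(brZl bil) !(brNl bil) !br_top // !scaler0 !add0r.
by rewrite (Nsym (br v x)) // addrACA subrr add0r opprK addrC addNr.
Qed.

Let vecS a b f : vec a b f = a *: vec 1 0 0 + (b *: vec 0 1 0 + vec 0 0 f).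
Proof. by rewrite !vecZ !vecD; apply: vec_eq; ring. Qed.

(** The defects [anti v] for v in [N], and [x, x], are multiples of [Z] sent to 0 by [br x]. Hence
    all vanish when [x, Z] is nonzero; otherwise the weights remove the defects and only [x, x] can
    remain. *)
Lemma left_mul_x : (forall v, v \in N -> br x v = - br v x) /\
  exists de, br x x = de *: Z /\ (de != 0 -> (m.-1)%:R * al + r`_0 = 0).
Proof.
have [de Ede] : exists de, br x x = de *: Z.
  by apply: top_unique => // u _; rewrite lei subrr.
have ZN : Z \in N by apply: vec_in fr _ _ _.
suff h : (forall v, v \in N -> anti v = 0) /\ (de != 0 -> br x Z = 0).
  have h1 v : v \in N -> br x v = - br v x.
    by move=> vN; apply/eqP; rewrite -addr_eq0 addrC; apply/eqP/h.1.
  split=> //; exists de; split=> // /h.2; rewrite h1 // top_x -scaleNr.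
  move/eqP; rewrite scaler_eq0 (negPf top_neq0) orbF oppr_eq0.
  by move/eqP.
have [xZ | xZ] := eqVneq (br x Z) 0; last first.
  split=> [v vN | d0].
    have [c Ec] := anti_top vN; have := anti_ann x v.
    rewrite Ec (brZr bil) => /eqP; rewrite scaler_eq0 (negPf xZ) orbF.
    by move=> /eqP->; rewrite scale0r.
  have : br x (br x x) = 0 by rewrite lei subrr.
  rewrite Ede (brZr bil) => /eqP; rewrite scaler_eq0 (negPf xZ) orbF.
  by rewrite (negPf d0).
split=> // v vN.
(* [Z] is itself a bracket of elements of [N], hence has no defect; so [x, Z] = 0 gives [Z, x] = 0
   and the weight of [Z] is zero. *)
have topx0 : (m.-1)%:R * al + r`_0 = 0.
  have := xZ; rewrite -[br x Z](addKr (br Z x)) -/(anti Z).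
  have [c Ec] := anti_top ZN; have -> : anti Z = 0.
    have <- : br (vec 1 0 0) (vec 0 0 'X^(m.-2)) = Z.
      rewrite (vec_br fr) /Z; apply: vec_eq => //.
      have -> : 'X^(m.-1) = 'X * 'X^(m.-2) :> {poly Cplx}.
        by rewrite -exprS prednK //; lia.
      by ring.
    by apply: anti_br; apply: vec_in fr _ _ _.
  rewrite addr0 top_x => /eqP; rewrite oppr_eq0 scaler_eq0 (negPf top_neq0) orbF.
  by move/eqP.
have r0n : al != 0 /\ r`_0 != 0.
  have mn0 : (m.-1)%:R != 0 :> Cplx by apply: natCplx_neq0; lia.
  have Er : r`_0 = - ((m.-1)%:R * al) by apply/eqP; rewrite -addr_eq0 addrC topx0.
  by case: ndeg; rewrite Er oppr_eq0 mulf_eq0 (negPf mn0) /=.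
(* The defect vanishes on the image of [br^~ x] and on brackets of [N]. Both weights being nonzero,
   these together span [N]. *)
have antiD w : w \in N -> anti (br w x) = 0.
  move=> wN; have [c Ec] := anti_top wN; have [wxN _] := idN x wN.
  have Ew : br x w = c *: Z - br w x by rewrite -Ec /anti addrC addKr.
  rewrite /anti (lei x w x) Ew Ede (brDl bil (c *: Z)) !(brZl bil) (brNl bil) (br_top wN) top_x topx0 scale0r.
  by rewrite !scaler0 subr0 add0r addrN.
have anti0 : anti 0 = 0 by rewrite /anti (br0l bil) (br0r bil) addr0.
have antiDD u w : anti (u + w) = anti u + anti w.
  by have := anti_lin 1 u w; rewrite !scale1r.
have antiZ c u : anti (c *: u) = c *: anti u.
  by have := anti_lin c u 0; rewrite anti0 !addr0.
have PE f : exists g, vec 0 0 f = f`_0 *: vec 0 0 1 + br (vec 1 0 0) (vec 0 0 g).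
  have [g Ef] := poly_headX f; exists g.
  by rewrite vecZ (vec_br fr) vecD {1}Ef; apply: vec_eq; ring.
have antiPE f : anti (vec 0 0 f) = f`_0 *: anti (vec 0 0 1).
  have [g ->] := PE f; rewrite antiDD antiZ anti_br ?addr0 //;
    exact: vec_in fr _ _ _.
have antiP f : anti (vec 0 0 f) = 0.
  suff /eqP : r`_0 *: anti (vec 0 0 1) = 0.
    rewrite scaler_eq0 (negPf r0n.2) => /eqP E.
    by rewrite antiPE E scaler0.
  rewrite -antiPE -[RHS](antiD _ (vec_in fr 0 0 1)) Dx; congr anti.
  by apply: vec_eq; rewrite ?derivC; ring.
have antiS a b f : anti (vec a b f) =
    a *: anti (vec 1 0 0) + b *: anti (vec 0 1 0).
  by rewrite vecS (antiDD (a *: _)) (antiDD (b *: _)) !antiZ antiP addr0.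
have anti_e1 : anti (vec 1 0 0) = 0.
  have := antiD _ (vec_in fr 1 0 0); rewrite Dx antiS.
  rewrite !mulr0 scale0r addr0 mulr1 => /eqP.
  by rewrite scaler_eq0 (negPf r0n.1) => /eqP.
have anti_en : anti (vec 0 1 0) = 0.
  have := antiD _ (vec_in fr 0 1 0); rewrite Dx antiS.
  rewrite !mulr0 scale0r add0r mulr1 => /eqP.
  rewrite scaler_eq0 mulf_eq0 (negPf r0n.1) (negPf (@natCplx_neq0 2 _)) //=.
  by move=> /eqP.
move: vN => /(frame_mem fr)[a [b [f ->]]].
by rewrite antiS anti_e1 anti_en !scaler0 addr0.
Qed.
End Structure.

(** * Choice of x outside the nilradical *)

Section Existence.
Variables (V : vectType Cplx) (br : V -> V -> V).
Implicit Types (f g p r : {poly Cplx}) (a b c : Cplx).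
Hypothesis bil : bilinear_br br.
Hypothesis lei : leibniz_identity br.
Variables (N : {vspace V}) (m : nat) (e1 en : V).
Variable (P : {linear {poly Cplx} -> V}).
Hypothesis fr : g2_frame br N m e1 en P.
Hypothesis fe : frame_free m e1 en P.
Hypothesis m4 : (3 < m)%N.

Lemma exists_x_action :
  \dim N = m.+2 -> \dim (fullv : {vspace V}) = m.+3 -> is_nilradical br N ->
  exists x al p r ka de, [/\ x_action br N m e1 en P x al p r ka de,
    al != 0 \/ r`_0 != 0 & de != 0 -> (m.-1)%:R * al + r`_0 = 0].
Proof.
move=> dN dV [idN nilN maxN].
have /subvPn[x _ xN] : ~~ (fullv <= N)%VS.
  by apply: contraL (leqnn m.+3) => /dimvS; rewrite dN dV ltnn.
have Nx : (N + <[x]>)%VS = fullv.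
  apply/eqP; rewrite eqEdim subvf dV ltnNge.
  apply: contra xN; rewrite -dN => dle; have := addvSl N <[x]>%VS.
  move=> sub; have /eqP -> : N == (N + <[x]>)%VS by rewrite eqEdim sub.
  by apply: subvP (addvSr _ _) _ (memv_line x).
have dec v : exists2 w, w \in N & exists c, v = w + c *: x.
  have := memvf v; rewrite -Nx => /memv_addP[w wN [_ /vlineP[c ->] ->]].
  by exists w => //; exists c.
(* Writing [x, x] = w + c x with w in [N], the identity [x, [x, x]] = 0 puts c^2 x in [N], which
   forces c = 0. *)
have xxN : br x x \in N.
  have [w wN [c Exx]] := dec (br x x).
  have : br x (br x x) = 0 by rewrite lei subrr.
  rewrite Exx (brDr bil) (brZr bil) Exx scalerDr scalerA addrA => E.
  have cx : (c * c) *: x \in N.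
    rewrite -[_ *: x](addKr (br x w + c *: w)) E addr0 rpredN rpredD ?rpredZ //.
    by have [] := idN w x wN.
  have [c0 | cn0] := eqVneq c 0; first by rewrite c0 scale0r addr0.
  case/negP: xN; rewrite -[x](scalerK (a := c * c)) ?mulf_neq0 //.
  by rewrite rpredZ.
have [al [p [r [ka Dx]]]] : exists al p r ka, forall a b f,
    br (nvec e1 en P a b f) x =
    nvec e1 en P (al * a) (2%:R * al * b)
      (a%:P * p + b%:P * (ka%:P * 'X^(m.-1) - 'X * p)
       + al%:P * 'X * f^`() + r * f).
  apply: (derivation_form fr fe m4 (D := br^~ x)) => [c u v | u v | v vN].
  - by rewrite (brDl bil) (brZl bil).
  - by rewrite lei addrC subrK.
  - by have [] := idN v x vN.
(* If both weights were zero, the whole algebra would be a nilpotent ideal containing [N], against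
   maximality and the dimensions. *)
have ndeg : al != 0 \/ r`_0 != 0.
  have [al0 | ] := eqVneq al 0; last by left.
  have [r0 | ] := eqVneq r`_0 0; last by right.
  have brN u v : br u v \in N.
    have [w wN [c ->]] := dec u; have [w' wN' [d ->]] := dec v.
    rewrite (brDl bil) rpredD //; first by have [] := idN w (w' + d *: x) wN.
    rewrite (brZl bil) rpredZ // (brDr bil) (brZr bil) rpredD ?rpredZ //.
    by have [] := idN w' x wN'.
  have nilV := nilpotent_full bil fr Dx dec brN al0 r0.
  have := maxN fullv _ nilV (subvf N).
  move=> fN; have := dV; rewrite fN ?dN; first by move=> /eqP; rewrite ltn_eqF.
  by move=> u v _; rewrite !memvf.
have [anti [de [Ede de0]]] := left_mul_x bil fr Dx lei fe (ltnW m4) idN xxN ndeg.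
exists x, al, p, r, ka, de; split=> //; split=> //.
by rewrite Ede vecZ (vec_P e1 en P); apply: vec_eq; ring.
Qed.
End Existence.

Lemma XderivXn (F : comNzRingType) k :
  'X * ('X^k)^`() = k%:R%:P * 'X^k :> {poly F}.
Proof.
case: k => [|k]; first by rewrite derivC mulr0 mul0r.
by rewrite derivXn /= polyC_natr exprS -mulr_natr; ring.
Qed.

(** * Effect of the changes of basis on the action of x *)

Section Changes.
Variables (V : vectType Cplx) (br : V -> V -> V).
Implicit Types (f g p r : {poly Cplx}) (a b c : Cplx).
Hypothesis bil : bilinear_br br.
Variables (N : {vspace V}) (m : nat) (e1 en : V).
Variable (P : {linear {poly Cplx} -> V}).
Hypothesis fr : g2_frame br N m e1 en P.
Variables (x : V) (al : Cplx) (p r : {poly Cplx}) (ka de : Cplx).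
Hypothesis ax : x_action br N m e1 en P x al p r ka de.
Notation vec := (nvec e1 en P).

Lemma x_action_scale c : c != 0 ->
  x_action br N m e1 en P (c *: x) (c * al) (c%:P * p) (c%:P * r)
    (c * ka) (c * c * de).
Proof.
move=> c0; split=> [a b f | v vN | |].
- by rewrite (brZr bil) (act_br ax) vecZ; apply: vec_eq; ring.
- by rewrite (brZr bil) (brZl bil) (act_anti ax) // scalerN.
- rewrite (brZr bil) (brZl bil) (act_sq ax) scalerA lin_scale.
  by congr (P _); ring.
- apply: contra (act_out ax) => cx.
  by rewrite -[x](scalerK c0) rpredZ.
Qed.

Lemma frame_anti u v : u \in N -> v \in N -> br u v = - br v u.
Proof.
move=> /(frame_mem fr)[a [b [f ->]]] /(frame_mem fr)[a' [b' [f' ->]]].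
by rewrite !(vec_br fr) vecN; apply: vec_eq; ring.
Qed.

(** In the square of x + y the cross terms cancel by antisymmetry and [y, y] = 0, so [de] is
    unchanged; p and r change by the action of y on e_1 and on the polynomials. *)
Lemma x_action_shift a f :
  x_action br N m e1 en P (x + vec a 0 f) al (p + 'X * f) (r - a%:P * 'X) ka de.
Proof.
have yN := vec_in fr a 0 f; split=> [a0 b0 f0 | v vN | |].
- rewrite (brDr bil x) (act_br ax) (vec_br fr) vecD.
  by apply: vec_eq; ring.
- rewrite (brDr bil x) (brDl bil x) (act_anti ax) // (frame_anti yN) //.
  by rewrite opprD.
- rewrite (brDr bil x) !(brDl bil x) (act_anti ax yN) (act_sq ax) addrA addrK.
  rewrite (vec_br fr) -[RHS]addr0; congr (_ + _).
  by rewrite /nvec !scale0r !add0r subrr linear0.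
- apply: contra (act_out ax) => xyN.
  by rewrite -[x](addrK (vec a 0 f)) rpredB.
Qed.

Lemma x_action_eq al' p' r' ka' de' :
  al = al' -> p = p' -> r = r' -> ka = ka' -> de = de' ->
  x_action br N m e1 en P x al' p' r' ka' de'.
Proof. by move=> <- <- <- <- <-. Qed.

(** Replaces each t^k by u t^k with e_1 and e_n fixed; the brackets persist because multiplication
    by u commutes with t. *)
Definition twist (u : {poly Cplx}) f := P (u * f).
Fact twist_linear u : linear (twist u).
Proof. by move=> a f g; rewrite /twist mulrDr linearD -scalerAr linearZ. Qed.
HB.instance Definition _ u :=
  GRing.isLinear.Build Cplx {poly Cplx} V _ (twist u) (twist_linear u).

Section Twist.
Variables u v z : {poly Cplx}.
Hypothesis uv : u * v = 1 + 'X^m * z.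

Let vec_twist a b f : nvec e1 en (twist u) a b f = vec a b (u * f).
Proof. by []. Qed.

Lemma frame_twist : g2_frame br N m e1 en (twist u).
Proof.
split=> [a b f a' b' f' | f | w].
- rewrite !vec_twist (frame_br fr) /= /twist; congr (P _); ring.
- by rewrite /= /twist mulrCA (frame_Xm fr).
split=> [/(frame_mem fr)[a [b [f ->]]] | [a [b [f ->]]]].
  exists a, b, (v * f); rewrite vec_twist mulrA uv.
  by rewrite (vec_mod fr a b (f' := f) (h := z * f)) //; ring.
by rewrite vec_twist; exact: (vec_in fr).
Qed.

(** Conjugating al t d/dt + r by u adds al t u'/u to r; the hypothesis on [r'] states this without
    division. Since u(0) = 1, t^(m-1) is fixed, and with it [ka] and [de]. *)
Lemma x_action_twist (r' w z' : {poly Cplx}) : (0 < m)%N -> u = 1 + 'X * w ->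
  al%:P * 'X * u^`() + r * u = r' * u + 'X^m * z' ->
  x_action br N m e1 en (twist u) x al (v * p) r' ka de.
Proof.
move=> m0 uE eu.
have Xm : 'X^m = 'X * 'X^(m.-1) :> {poly Cplx} by rewrite -exprS prednK.
split=> [a b f | y yN | |]; first 1 last.
- exact: act_anti ax y yN.
- rewrite (act_sq ax) /= /twist; have := vec_mod fr 0 0 (f := u * (de%:P * 'X^(m.-1)))
    (f' := de%:P * 'X^(m.-1)) (h := w * de%:P).
  by rewrite -!(vec_P e1 en P) => -> //; rewrite uE Xm; ring.
- exact: act_out ax.
rewrite !vec_twist (act_br ax).
apply: (vec_mod fr _ _
  (h := z' * f + (b%:P * 'X - a%:P) * z * p - b%:P * w * ka%:P)).
rewrite derivM.
have -> : a%:P * p + b%:P * (ka%:P * 'X^(m.-1) - 'X * p) +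
    al%:P * 'X * (u^`() * f + u * f^`()) + r * (u * f) =
    a%:P * p + b%:P * (ka%:P * 'X^(m.-1) - 'X * p) +
    (al%:P * 'X * u^`() + r * u) * f + al%:P * 'X * u * f^`() by ring.
rewrite eu.
have -> : u * (a%:P * (v * p) + b%:P * (ka%:P * 'X^(m.-1) - 'X * (v * p)) +
    al%:P * 'X * f^`() + r' * f) = (u * v) * (a%:P - b%:P * 'X) * p +
    u * b%:P * ka%:P * 'X^(m.-1) + u * (al%:P * 'X * f^`() + r' * f) by ring.
by rewrite uv uE Xm; ring.
Qed.
End Twist.

Section Move.
Variables (s k : Cplx).
Let e1' := vec 1 0 s%:P.
Let en' := vec 0 1 (k%:P * 'X^(m.-1) - s%:P * 'X).
Hypothesis m0 : (0 < m)%N.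

Let Xm : 'X^m = 'X * 'X^(m.-1) :> {poly Cplx}.
Proof. by rewrite -exprS prednK. Qed.

Let vec_move a b f : nvec e1' en' P a b f =
  vec a b (f + a%:P * s%:P + b%:P * (k%:P * 'X^(m.-1) - s%:P * 'X)).
Proof.
rewrite {1}/nvec /e1' /en' !vecZ (vec_P e1 en P) !vecD.
by apply: vec_eq; ring.
Qed.

(** The term - s t in the new e_n preserves [e_1, e_n] = 0: its bracket with e_1 is - s t^2, against
    [s, e_n] = s t^2. The term k t^(m-1) is central. *)
Lemma frame_move : g2_frame br N m e1' en' P.
Proof.
split=> [a b f a' b' f' | f | w].
- rewrite !vec_move (vec_br fr) (vec_P e1 en P).
  apply: (vec_mod fr _ _ (h := k%:P * ((a%:P - b%:P * 'X) * b'%:P -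
    (a'%:P - b'%:P * 'X) * b%:P))).
  by rewrite Xm; ring.
- exact: frame_Xm fr f.
split=> [/(frame_mem fr)[a [b [f ->]]] | [a [b [f ->]]]].
  exists a, b, (f - (a%:P * s%:P + b%:P * (k%:P * 'X^(m.-1) - s%:P * 'X))).
  by rewrite vec_move; apply: vec_eq => //; ring.
by rewrite vec_move; exact: (vec_in fr).
Qed.

(** The coefficient of k is the weight of t^(m-1) minus the weight 2 al of e_n; likewise that of s
    compares r with the weight al of e_1. *)
Lemma x_action_move :
  x_action br N m e1' en' P x al (p + s%:P * (r - al%:P)) r
    (ka + k * ((m.-1)%:R * al + r`_0 - 2%:R * al)) de.
Proof.
have [g Er] := poly_headX r.
split=> [a b f | y yN | |]; first 1 last.
- exact: act_anti ax y yN.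
- exact: act_sq ax.
- exact: act_out ax.
rewrite !vec_move (act_br ax); apply: (vec_mod fr _ _ (h := b%:P * k%:P * g)).
rewrite !derivD !deriv_mulC derivB !deriv_mulC derivX derivC mulr0 addr0.
have -> : al%:P * 'X * (f^`() + b%:P * (k%:P * ('X^(m.-1))^`() - s%:P * 1)) =
  al%:P * 'X * f^`() + al%:P * b%:P * (k%:P * ('X * ('X^(m.-1))^`()) - s%:P * 'X).
  by ring.
rewrite XderivXn Xm.
have -> : r * (f + a%:P * s%:P + b%:P * (k%:P * 'X^(m.-1) - s%:P * 'X)) =
  r * (f + a%:P * s%:P - b%:P * s%:P * 'X) + b%:P * k%:P * ((r`_0)%:P + 'X * g) * 'X^(m.-1).
  by rewrite -Er; ring.
by ring.
Qed.
End Move.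

End Changes.

(** * From frames back to tables of brackets *)

Section Tables.
Variables (V : vectType Cplx) (br : V -> V -> V).
Implicit Types (f g p r : {poly Cplx}) (a b c : Cplx).
Variables (N : {vspace V}) (m : nat) (e1 en : V).
Variable (P : {linear {poly Cplx} -> V}).
Hypothesis fr : g2_frame br N m e1 en P.
Notation vec := (nvec e1 en P).

Definition frame_seq i : V :=
  if i == 1%N then e1 else if i == m.+2 then en else P 'X^(i - 2).
Notation e := frame_seq.

Lemma frame_seq1 : e 1 = vec 1 0 0. Proof. exact: vec_e1. Qed.
Lemma frame_seqn : e m.+2 = vec 0 1 0.
Proof. by rewrite /frame_seq eqxx; exact: vec_en. Qed.
Lemma frame_seqP k : (k < m)%N -> e k.+2 = vec 0 0 'X^k.
Proof.
by move=> km; rewrite /frame_seq !eqSS /= ltn_eqF // subn2; exact: vec_P.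
Qed.
Lemma frame_seq_high k : (m <= k)%N -> vec 0 0 'X^k = 0.
Proof.
by move=> mk; rewrite -vec_P -(subnKC mk) exprD (frame_Xm fr).
Qed.

Lemma frame_coefs f : P f = \sum_(0 <= k < m) f`_k *: e k.+2.
Proof.
rewrite -{1}(poly_take_drop m f) linearD mulrC (frame_Xm fr) addr0.
rewrite /take_poly poly_def linear_sum big_mkord; apply: eq_bigr => k _.
by rewrite linearZ frame_seqP // -vec_P.
Qed.

Lemma index_cases i : (1 <= i <= m.+2)%N ->
  [\/ i = 1%N, i = m.+2 | exists2 k, (k < m)%N & i = k.+2].
Proof.
move=> im; have [->|i1] := eqVneq i 1%N; first by constructor 1.
have [->|i2] := eqVneq i m.+2; first by constructor 2.
by constructor 3; exists (i - 2)%N; lia.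
Qed.

(** The vectors span [N] and their number is its dimension. For the table, brackets of monomials are
    shifts of exponent by 1 or 2, which give 0 on reaching m. *)
Lemma frame_g2_basis : \dim N = m.+2 -> g2_basis br m.+2 N e.
Proof.
move=> dN; split.
  rewrite basisEdim size_mkseq dN leqnn andbT; apply/subvP=> v.
  have eI i : (1 <= i <= m.+2)%N -> e i \in <<eseq m.+2 e>>%VS.
    move=> iP; apply: memv_span; apply/mapP; exists i.-1.
      by rewrite mem_iota; lia.
    by rewrite prednK //; lia.
  move=> /(frame_mem fr)[a [b [f ->]]].
  have -> : vec a b f = a *: e 1 + b *: e m.+2 + P f.
    by rewrite {1}/nvec /frame_seq eqxx.
  rewrite frame_coefs big_mkord !rpredD ?rpredZ ?eI ?leqnn //.
  by apply: rpred_sum => k _; rewrite rpredZ // eI //; have := ltn_ord k; lia.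
have v0 : vec 0 0 0 = 0 by rewrite /nvec !scale0r linear0 !addr0.
have shift k d : (k < m)%N -> vec 0 0 ('X^(k + d)) =
    if (k + d < m)%N then e (k + d).+2 else 0.
  by move=> km; case: ltnP => kd; [rewrite frame_seqP | rewrite frame_seq_high].
move=> i j /index_cases[-> | -> | [k km ->]] /index_cases[-> | -> | [l lm ->]];
  rewrite ?frame_seq1 ?frame_seqn ?frame_seqP // (vec_br fr) /g2_table /=.
- transitivity (vec 0 0 0); first by apply: vec_eq => //; ring.
  by rewrite v0.
- transitivity (vec 0 0 0); first by apply: vec_eq => //; ring.
  by rewrite v0; repeat case: ifP => //; lia.
- transitivity (vec 0 0 'X^(l + 1)).
  by apply: vec_eq => //; rewrite (exprD _ l); ring.
  by rewrite shift // addn1; repeat case: ifP => //; lia.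
- transitivity (vec 0 0 0); first by apply: vec_eq => //; ring.
  by rewrite v0; repeat case: ifP => //; lia.
- transitivity (vec 0 0 0); first by apply: vec_eq => //; ring.
  by rewrite v0; repeat case: ifP => //; lia.
- transitivity (- vec 0 0 'X^(l + 2)).
  by rewrite vecN (exprD _ l); apply: vec_eq; ring.
  by rewrite shift // addn2; repeat case: ifP => //; rewrite ?oppr0 //; lia.
- transitivity (- vec 0 0 'X^(k + 1)).
  by rewrite vecN (exprD _ k); apply: vec_eq; ring.
  by rewrite shift // addn1; repeat case: ifP => //; rewrite ?oppr0 //; lia.
- transitivity (vec 0 0 'X^(k + 2)).
  by apply: vec_eq => //; rewrite (exprD _ k); ring.
  by rewrite shift // addn2; repeat case: ifP => //; lia.
- transitivity (vec 0 0 0); first by apply: vec_eq => //; ring.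
  by rewrite v0; repeat case: ifP => //; lia.
Qed.

Variables (x : V).

Lemma xbrackets_R1 (g : {poly Cplx}) :
  x_action br N m e1 en P x 0 0 (1 + 'X^2 * g) 0 0 -> typeR1 br m.+2 e x.
Proof.
(* In t^k (1 + t^2 g), with i = k + 2, the coefficient of e_t is that of g at t - i - 2, whereas the
   parameter there has index t - i + 2: hence the offset 4. *)
move=> ax; exists (fun j => g`_(j - 4)).
suff h i : (1 <= i <= m.+2)%N -> br (e i) x =
    if (2 <= i <= m.+2 - 1)%N then
      e i + \sum_(i + 2 <= t < m.+2) g`_(t - i + 2 - 4) *: e t else 0.
  split=> [i im|]; last by rewrite (act_sq ax) mul0r linear0.
  rewrite -h //; split=> //; apply: (act_anti ax).
  case: (index_cases im) => [->|->|[k km ->]];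
    by rewrite ?frame_seq1 ?frame_seqn ?frame_seqP //; exact: (vec_in fr).
have v0 : vec 0 0 0 = 0 by rewrite /nvec !scale0r linear0 !addr0.
move=> /index_cases[-> | -> | [k km ->]].
- rewrite frame_seq1 (act_br ax) /= -[RHS]v0; apply: vec_eq; rewrite ?deriv0; ring.
- rewrite frame_seqn (act_br ax) ifF; last lia.
  by rewrite -[RHS]v0; apply: vec_eq; rewrite ?deriv0; ring.
rewrite ifT; last lia.
rewrite [in LHS]frame_seqP // (act_br ax).
transitivity (vec 0 0 'X^k + P ('X^(k + 2) * g)).
  by rewrite (vec_P e1 en P ('X^(k + 2) * g)) vecD (exprD _ k); apply: vec_eq; ring.
rewrite frame_seqP // frame_coefs; congr (_ + _).
rewrite (_ : (k.+2 + 2 = (k + 2).+2)%N) // 2!big_add1 /=.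
rewrite [RHS](big_nat_widenl _ 0) //.
rewrite [RHS]big_mkcond /=; apply: eq_big_nat => j jm.
rewrite coefXnM ltnNge; case: leqP => kj /=; last by rewrite scale0r.
by congr (g`_ _ *: _); lia.
Qed.

(** The common table from which R_2, ..., R_5 are specialized. *)
Lemma xbrackets_diag (p0 b2 ka de : Cplx) : (3 < m)%N ->
  x_action br N m e1 en P x 1 p0%:P b2%:P ka de ->
  xbrackets br m.+2 e x
    (fun i => if i == 1%N then e 1%N + p0 *: e 2%N
              else if (2 <= i <= m.+2 - 1)%N then ((i - 2)%:R + b2) *: e i
              else - (p0 *: e 3%N) + ka *: e (m.+2 - 1)%N + 2%:R *: e m.+2)
    (de *: e (m.+2 - 1)%N).
Proof.
move=> m4 ax.
have elast : e (m.+2 - 1)%N = vec 0 0 'X^(m.-1).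
  by rewrite -frame_seqP; [congr e; lia | lia].
have inN i : (1 <= i <= m.+2)%N -> e i \in N.
  move=> im; case: (index_cases im) => [->|->|[k km ->]];
    by rewrite ?frame_seq1 ?frame_seqn ?frame_seqP //; exact: (vec_in fr).
pose F i := if i == 1%N then e 1%N + p0 *: e 2%N
  else if (2 <= i <= m.+2 - 1)%N then ((i - 2)%:R + b2) *: e i
  else - (p0 *: e 3%N) + ka *: e (m.+2 - 1)%N + 2%:R *: e m.+2.
suff h i : (1 <= i <= m.+2)%N -> br (e i) x = F i.
  split=> [i im|]; first by rewrite (act_anti ax (inN i im)) h.
  by rewrite (act_sq ax) elast (vec_P e1 en P) vecZ; apply: vec_eq; ring.
move=> /index_cases[-> | -> | [k km ->]].
- rewrite /F eqxx (frame_seqP (k := 0)) ?frame_seq1 ?(act_br ax); last lia.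
  by rewrite vecZ vecD expr0 deriv0; apply: vec_eq; ring.
- rewrite /F ifF; last by lia.
  rewrite elast frame_seqn.
  rewrite (frame_seqP (k := 1)) ?(act_br ax); last lia.
  by rewrite !vecZ vecN !vecD deriv0 expr1; apply: vec_eq; ring.
- rewrite /F ifT; last by lia.
  rewrite frame_seqP // (act_br ax) vecZ.
  apply: vec_eq; [ring | ring |].
  rewrite (_ : k.+2 - 2 = k)%N ?subn2 // -mulrA XderivXn; ring.
Qed.

Lemma xbrackets_ext (E F F' : nat -> V) w w' :
  (forall i, (1 <= i <= m.+2)%N -> F i = F' i) -> w = w' ->
  xbrackets br m.+2 E x F w -> xbrackets br m.+2 E x F' w'.
Proof. by move=> FF' <- [h xx]; split=> // i im; rewrite -FF' //; apply: h. Qed.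

(** The values of [b2] that permit nonzero [p0], [ka] and [de] are 1, 3 - m = 5 - n and 1 - m = 3 -
    n. They are distinct, so at most one of the three survives, and R_5 is the case away from all of
    them. *)
Lemma types_diag (p0 b2 ka de : Cplx) : (3 < m)%N ->
  x_action br N m e1 en P x 1 p0%:P b2%:P ka de ->
  (p0 != 0 -> b2 = 1) ->
  (ka != 0 -> (m.-1)%:R + b2 - 2%:R = 0) ->
  (de != 0 -> (m.-1)%:R + b2 = 0) ->
  typeR2 br m.+2 e x \/ typeR3 br m.+2 e x \/
  typeR4 br m.+2 e x \/ typeR5 br m.+2 e x.
Proof.
move=> m4 ax hp hka hde; have diag := xbrackets_diag m4 ax.
have natZ k : (k.+2%:Z)%:~R = k%:R + 2%:R :> Cplx by rewrite -natrD addn2.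
have mn1 : (m.-1)%:R = m%:R - 1 :> Cplx.
  by apply/eqP; rewrite eq_sym subr_eq natr1 prednK //; lia.
rewrite mn1 in hka hde.
have mid k : (k < m)%N -> (k.+1 < m.+2 - 1)%N by lia.
have last_mid : (m.+1 < m.+2 - 1)%N = false by lia.
have zero (c : Cplx) (d : Cplx) : (c != 0 -> d = 0) -> d != 0 -> c = 0.
  by move=> h; apply: contraNeq => /h /eqP.
have z5 : (5 - m.+2%:Z)%:~R = 3%:R - m%:R :> Cplx.
  by rewrite rmorphB /= natZ; ring.
have z3 : (3 - m.+2%:Z)%:~R = 1 - m%:R :> Cplx.
  by rewrite rmorphB /= natZ; ring.
have [b1 | nb1] := eqVneq b2 1.
  have ka0 : ka = 0.
    apply: (zero _ _ hka); rewrite b1.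
    rewrite (_ : _ - _ = (m - 2)%:R); first by apply: natCplx_neq0; lia.
    by rewrite natrB; [ring | lia].
  have de0 : de = 0.
    apply: (zero _ _ hde); rewrite b1 subrK.
    by apply: natCplx_neq0; lia.
  left; exists p0; apply: xbrackets_ext diag; last by rewrite de0 scale0r.
  move=> i /index_cases[-> // | -> | [k km ->]] /=.
    by rewrite last_mid ka0 scale0r addr0.
  rewrite mid //; congr (_ *: _).
  by rewrite b1 rmorphB /= natZ subn2 /=; ring.
have p00 : p0 = 0 by apply/eqP; apply: contraNT nb1 => /hp ->.
right; have [b5 | nb5] := eqVneq b2 (3%:R - m%:R).
  have de0 : de = 0.
    apply: (zero _ _ hde); rewrite b5 (_ : _ + _ = 2%:R); last by ring.
    exact: natCplx_neq0.
  left; exists ka; apply: xbrackets_ext diag; last by rewrite de0 scale0r.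
  move=> i /index_cases[-> | -> | [k km ->]] /=.
  - by rewrite p00 scale0r addr0.
  - by rewrite last_mid p00 scale0r oppr0 add0r.
  rewrite mid //; congr (_ *: _).
  by rewrite b5 rmorphB rmorphD /= !natZ subn2 /=; ring.
have ka0 : ka = 0.
  apply: (zero _ _ hka); apply: contraNneq nb5 => E.
  by apply/eqP/subr0_eq; rewrite -E; ring.
right; have [b3 | nb3] := eqVneq b2 (1 - m%:R).
  left; exists de; apply: xbrackets_ext diag => //.
  move=> i /index_cases[-> | -> | [k km ->]] /=.
  - by rewrite p00 scale0r addr0.
  - by rewrite last_mid p00 ka0 !scale0r oppr0 !add0r.
  rewrite mid //; congr (_ *: _).
  by rewrite b3 rmorphB rmorphD /= !natZ subn2 /=; ring.
have de0 : de = 0.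
  apply: (zero _ _ hde); apply: contraNneq nb3 => E.
  by apply/eqP/subr0_eq; rewrite -E; ring.
right; exists b2; split; rewrite ?z5 ?z3 //.
apply: xbrackets_ext diag; last by rewrite de0 scale0r.
move=> i /index_cases[-> | -> | [k km ->]] /=.
- by rewrite p00 scale0r addr0.
- by rewrite last_mid p00 ka0 !scale0r oppr0 !add0r.
by rewrite mid.
Qed.
End Tables.

(** * Normal forms of the action of x *)

Section NormalForm.
Variables (V : vectType Cplx) (br : V -> V -> V).
Implicit Types (f g p r : {poly Cplx}) (a b c : Cplx).
Hypothesis bil : bilinear_br br.
Variables (N : {vspace V}) (m : nat).
Hypothesis m4 : (3 < m)%N.

Lemma normal_form_R1 e1 en (P : {linear {poly Cplx} -> V}) x p r ka :
  g2_frame br N m e1 en P -> x_action br N m e1 en P x 0 p r ka 0 ->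
  r`_0 != 0 ->
  exists e1' en' x' g, g2_frame br N m e1' en' P /\
    x_action br N m e1' en' P x' 0 0 (1 + 'X^2 * g) 0 0.
Proof.
move=> fr ax r0.
have /(x_action_scale bil)/(_ _ (invr_neq0 r0)) := ax.
set c := (r`_0)^-1 => ax1; have [p1 Ep] := poly_headX (c%:P * p).
have [r1 Er] := poly_headX (c%:P * r); have [r2 Er1] := poly_headX r1.
have cr0 : (c%:P * r)`_0 = 1 by rewrite coefCM mulVf.
(* Now al = 0 and r(0) = 1, so the move adds s to p(0) and k to [ka]; both are cancelled. *)
pose s := - (c%:P * p)`_0; pose k := - (c * ka).
have ax2 := x_action_move fr ax1 s k ltac:(lia).
have fr2 := frame_move fr s k ltac:(lia).
(* The shift along e_1 removes the coefficient of t in r; the polynomial part removes p, by now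
   divisible by t. *)
have ax3 := x_action_shift bil fr2 ax2 (r1`_0) (- (p1 + s%:P * r1)).
do 3 eexists; exists r2; split; first exact: fr2.
refine (x_action_eq ax3 _ _ _ _ _).
- by rewrite mulr0.
- by rewrite Ep Er cr0 mulr0 /s polyCN; ring.
- by rewrite Er cr0 {1}Er1; ring.
- by rewrite cr0 /k; ring.
- by rewrite mulr0.
Qed.

Lemma normal_form_diag e1 en (P : {linear {poly Cplx} -> V}) x al p r ka de :
  g2_frame br N m e1 en P -> x_action br N m e1 en P x al p r ka de ->
  al != 0 -> (de != 0 -> (m.-1)%:R * al + r`_0 = 0) ->
  exists e1' en' (P' : {linear {poly Cplx} -> V}) x' (p0 b2 ka' de' : Cplx),
    [/\ g2_frame br N m e1' en' P' /\
        x_action br N m e1' en' P' x' 1 p0%:P b2%:P ka' de',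
        p0 != 0 -> b2 = 1, ka' != 0 -> (m.-1)%:R + b2 - 2%:R = 0 &
        de' != 0 -> (m.-1)%:R + b2 = 0].
Proof.
move=> fr ax al0 hde.
have /(x_action_scale bil)/(_ _ (invr_neq0 al0)) := ax.
set c := al^-1; rewrite /c mulVf // -/c => ax1.
have m0 : (0 < m)%N by lia.
(* Twisting by this u = 1 + t w makes r the constant [b2]. *)
have [w [z Eu]] := @euler_solution _ (c%:P * r) m natCplx_neq0 m0.
have [v [z' uv]] := mulX_inv_mod w m.
set b2 := (c%:P * r)`_0 in Eu.
have ax2 : x_action br N m e1 en (twist P (1 + 'X * w)) (c *: x) 1
    (v * (c%:P * p)) b2%:P (c * ka) (c * c * de).
  by apply: (x_action_twist fr ax1 uv m0 erefl (z' := z)); rewrite mul1r.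
have fr2 := frame_twist fr uv.
set q := v * _ in ax2; have [q1 Eq] := poly_headX q.
(* The move changes p(0) by s (b2 - 1) and [ka] by k d; each is cancelled unless its factor is zero,
   in which case the value 0 leaves it alone. *)
pose s := if b2 == 1 then 0 else q`_0 / (1 - b2).
pose d := (m.-1)%:R + b2 - 2%:R.
pose k := if d == 0 then 0 else - (c * ka) / d.
have ax3 := x_action_move fr2 ax2 s k m0.
have fr3 := frame_move fr2 s k m0.
have ax4 := x_action_shift bil fr3 ax3 0 (- q1).
exists (nvec e1 en (twist P (1 + 'X * w)) 1 0 s%:P).
do 3 eexists; exists (q`_0 + s * (b2 - 1)), b2, (c * ka + k * d), (c * c * de).
split; first split; first exact: fr3.
- refine (x_action_eq ax4 _ _ _ _ _) => //.
  + by rewrite {1}Eq; ring.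
  + by ring.
  + by rewrite coefC eqxx /d; ring.
- apply: contraNeq => nb1; rewrite /s (negPf nb1).
  by rewrite -(opprB 1 b2) mulrN divfK ?subrr // subr_eq0 eq_sym.
- rewrite -/d; apply: contraNeq => nd.
  by rewrite /k (negPf nd) divfK // addrN.
rewrite mulf_eq0 negb_or => /andP[_ /hde E].
transitivity (c * ((m.-1)%:R * al + r`_0)); last by rewrite E mulr0.
by rewrite /b2 coefCM mulrDr mulrCA mulVf // mulr1.
Qed.
End NormalForm.

(** * The classification, by whether the weight al of e_1 vanishes *)

Theorem theorem3p4 (n : nat) (V : vectType Cplx) (br : V -> V -> V)
  (N : {vspace V}) :
  (5 < n)%N ->
  \dim (fullv : {vspace V}) = n.+1 ->
  bilinear_br br -> leibniz_identity br ->
  solvable_alg br ->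
  is_nilradical br N -> isomorphic_to_g2 br n N ->
  exists (e : nat -> V) (x : V),
    [/\ g2_basis br n N e,
        basis_of fullv (x :: eseq n e) &
        (typeR1 br n e x \/ typeR2 br n e x \/ typeR3 br n e x \/
         typeR4 br n e x \/ typeR5 br n e x)].
Proof.
case: n => [|[|m]] // n5 dV bil lei _ nilN [e0 eN].
have m4 : (3 < m)%N by lia.
have m1 : (1 < m)%N by lia.
have dN : \dim N = m.+2.
  by case: eN => bN _; rewrite -(span_basis bN) (eqP (basis_free bN)) size_mkseq.
have fr0 := g2_basis_frame bil eN m1.
have fe0 := g2_basis_free eN m1.
have [x [al [p [r [ka [de [ax ndeg hde]]]]]]] :=
  exists_x_action bil lei fr0 fe0 m4 dN dV nilN.
have finish e1 en (P : {linear {poly Cplx} -> V}) y al' p' r' ka' de' :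
    g2_frame br N m e1 en P -> x_action br N m e1 en P y al' p' r' ka' de' ->
    g2_basis br m.+2 N (frame_seq m e1 en P) /\
    basis_of fullv (y :: eseq m.+2 (frame_seq m e1 en P)).
  move=> fr ay; have eB := frame_g2_basis fr dN; split=> //.
  have [bN _] := eB; rewrite basisEfree free_cons (span_basis bN) (act_out ay).
  by rewrite (basis_free bN) subvf dV /= size_map size_iota.
have [al0 | aln0] := eqVneq al 0.
  have r0 : r`_0 != 0 by case: ndeg; rewrite ?al0 ?eqxx.
  (* For al = 0, a nonzero [de] would force r(0) = 0. *)
  have de0 : de = 0.
    by apply/eqP; apply: contraNT r0 => /hde; rewrite al0 mulr0 add0r => ->.
  rewrite al0 de0 in ax.
  have [e1 [en [y [g [fr ay]]]]] := normal_form_R1 bil m4 fr0 ax r0.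
  have [eB yB] := finish _ _ _ _ _ _ _ _ _ fr ay.
  exists (frame_seq m e1 en (coef_comb m e0)), y; split=> //.
  by left; exact (xbrackets_R1 fr ay).
have [e1 [en [P [y [p0 [b2 [ka' [de' [[fr ay] h1 h2 h3]]]]]]]]] :=
  normal_form_diag bil m4 fr0 ax aln0 hde.
have [eB yB] := finish _ _ _ _ _ _ _ _ _ fr ay.
exists (frame_seq m e1 en P), y; split=> //.
by right; exact (types_diag fr m4 ay h1 h2 h3).
Qed.
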